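(* Let $\mathcal L$ be a semilattice, $(\mathfrak A,(A_i)_{i\in\mathcal L})$ an $\mathcal L$-graded $C^*$-algebra, $B$ a $C^*$-algebra and $\psi:\mathfrak A\to B$ a homomorphism. For every finite subsemilattice $\mathcal F$ of $\mathcal L$ let $\psi_{\mathcal F}:\mathfrak A_{\mathcal F}\to B$ be the restriction of $\psi$ to $\mathfrak A_{\mathcal F}$, and for $i\in\mathcal L$ write $\psi_i:A_i\to B$ for $\psi_{\{i\}}$. (a) For all $j,k\in\mathcal L$ and all $x\in A_j$, $y\in A_k$ we have $\psi_{j\wedge k}(xy)=\psi_j(x)\psi_k(y)$. (b) The following conditions are equivalent: (i) the map $\psi$ is surjective; (ii) the family $(\psi_i(A_i))_{i\in\mathcal L}$ is total in $B$. (c) The following conditions are equivalent: (i) the map $\psi$ is injective; (ii) for every finite subsemilattice $\mathcal F$ of $\mathcal L$, $\psi_{\mathcal F}$ is injective; (iii) for every $i\in\mathcal L$ the map $\psi_i$ is injective, and the family $(\psi_i(A_i))_{i\in\mathcal L}$ of subspaces of $B$ is in direct sum (linearly independent).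
   Context: A semilattice is a partially ordered set $\mathcal L$ in which any two elements $k,\ell$ have a greatest lower bound $k\wedge\ell$; a subsemilattice is a subset closed under $\wedge$. A $C^*$-algebra $\mathfrak A$ is $\mathcal L$-graded with components $(A_i)_{i\in\mathcal L}$, written $(\mathfrak A,(A_i)_{i\in\mathcal L})$, if $(A_i)_{i\in\mathcal L}$ is a family of sub-$C^*$-algebras of $\mathfrak A$ which is linearly independent, total, and satisfies $A_iA_j\subset A_{i\wedge j}$ for all $i,j\in\mathcal L$. A family $(E_i)$ of subspaces of a vector space is linearly independent (in direct sum) if, whenever $S_i\in E_i$, only finitely many $S_i$ are nonzero and $\sum_i S_i=0$, then all $S_i=0$; a family of subsets of a normed space is total if the linear span of its union is dense. For $\mathcal M\subset\mathcal L$, $\mathfrak A_{\mathcal M}=\bigoplus_{i\in\mathcal M}A_i$ (algebraic sum inside $\mathfrak A$). Homomorphisms of $C^*$-algebras are $*$-homomorphisms. *)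

(* Defs.v *)
From HB Require Import structures.
From mathcomp Require Import all_boot all_order all_algebra.
From mathcomp Require Import complex.
From mathcomp Require Import all_classical all_reals all_analysis.

Set Implicit Arguments.
Unset Strict Implicit.
Unset Printing Implicit Defensive.

Import Order.TTheory GRing.Theory Num.Theory.
Import numFieldNormedType.Exports.

Local Open Scope classical_set_scope.
Local Open Scope ring_scope.

Reserved Notation "x ** y" (at level 40, left associativity).
Reserved Notation "{ 'starhom' A -> B }"
  (at level 0, A at level 98, B at level 99, format "{ 'starhom'  A  ->  B }").

(* The algebra is not assumed to be unital, so its product cannot come from the
   (always unital) rings of the algebraic hierarchy.  As usual for normed
   modules over R[i], the norm takes its values in the nonnegative reals seen
   inside R[i]. *)
HB.mixin Record CompleteNormedModule_isCStarAlgebra (R : realType) A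
    of CompleteNormedModule R[i] A := {
  cmul : A -> A -> A;
  cstar : A -> A;
  cmulA : associative cmul;
  cmulDl : left_distributive cmul +%R;
  cmulDr : right_distributive cmul +%R;
  cscaleAl : forall (a : R[i]) (x y : A), a *: cmul x y = cmul (a *: x) y;
  cscaleAr : forall (a : R[i]) (x y : A), a *: cmul x y = cmul x (a *: y);
  cstarK : involutive cstar;
  cstarD : {morph cstar : x y / x + y};
  cstarZ : forall (a : R[i]) (x : A), cstar (a *: x) = a^* *: cstar x;
  cstarM : forall x y : A, cstar (cmul x y) = cmul (cstar y) (cstar x);
  normr_cmul : forall x y : A, `|cmul x y| <= `|x| * `|y|;
  normr_cstar_cmul : forall x : A, `|cmul (cstar x) x| = `|x| ^+ 2
}.

#[short(type="cstarAlgType")]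
HB.structure Definition CStarAlgebra (R : realType) :=
  {A of CompleteNormedModule_isCStarAlgebra R A & CompleteNormedModule R[i] A}.

Notation "x ** y" := (cmul x y) : ring_scope.

HB.mixin Record isStarMultiplicative (R : realType) (A B : cstarAlgType R)
    (f : A -> B) := {
  starhomM : {morph f : x y / x ** y};
  starhom_star : {morph f : x / cstar x}
}.

#[short(type="starHomType")]
HB.structure Definition StarHom (R : realType) (A B : cstarAlgType R) :=
  {f of isStarMultiplicative R A B f & @GRing.Linear R[i] A B *:%R f}.

Notation "{ 'starhom' A -> B }" := (@StarHom.type _ A B) : type_scope.

Definition linear_subspace (K : numFieldType) (V : lmodType K) (E : set V) : Prop :=
  [/\ E 0, (forall x y, E x -> E y -> E (x + y))
    & (forall (a : K) x, E x -> E (a *: x))].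

Definition sub_cstar_algebra (R : realType) (A : cstarAlgType R)
    (S : set A) : Prop :=
  [/\ linear_subspace S, (forall x y, S x -> S y -> S (x ** y)),
      (forall x, S x -> S (cstar x)) & closed S].

(* A sum over \in is 0 by convention when its support is infinite; the finiteness
   hypothesis excludes that case. *)
Definition linearly_independent (K : numFieldType) (V : lmodType K)
    (I : choiceType) (E : I -> set V) : Prop :=
  forall s : I -> V, (forall i, E i (s i)) ->
    finite_set [set i | s i != 0] ->
    \sum_(i \in [set: I]) s i = 0 -> forall i, s i = 0.

Definition linear_span (K : numFieldType) (V : lmodType K) (E : set V) :
    set V :=
  smallest (@linear_subspace K V) E.

Definition total_family (K : numFieldType) (V : normedModType K) (I : Type)
    (E : I -> set V) : Prop :=
  dense (linear_span (\bigcup_i E i)).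

Definition graded (R : realType) (d : Order.disp_t) (L : meetSemilatticeType d)
    (A : cstarAlgType R) (A_ : L -> set A) : Prop :=
  [/\ (forall i, sub_cstar_algebra (A_ i)),
      linearly_independent A_, total_family A_
    & (forall i j x y, A_ i x -> A_ j y -> A_ (i `&` j)%O (x ** y))].

Definition subsemilattice (d : Order.disp_t) (L : meetSemilatticeType d)
    (F : set L) : Prop :=
  forall i j, F i -> F j -> F (i `&` j)%O.

Definition algebraic_sum (K : numFieldType) (V : lmodType K) (I : choiceType)
    (E : I -> set V) (M : set I) : set V :=
  [set x | exists s : I -> V, [/\ (forall i, M i -> E i (s i)),
     finite_set (M `&` [set i | s i != 0]) & x = \sum_(i \in M) s i]].

(* Restricting a map to the sum over the singleton i is restricting it to E i. *)
Lemma algebraic_sum1 (K : numFieldType) (V : lmodType K) (I : choiceType)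
    (E : I -> set V) (i : I) : algebraic_sum E [set i] = E i.
Proof.
apply/seteqP; split=> x.
  by move=> [s [Es _ ->]]; rewrite fsbig_set1; apply: Es.
move=> Ex; exists (fun=> x); split=> [_ ->//| |]; last by rewrite fsbig_set1.
exact/finite_setIl/finite_set1.
Qed.

Lemma graded_mul_subproof (R : realType) (d : Order.disp_t)
    (L : meetSemilatticeType d) (A : cstarAlgType R) (A_ : L -> set A)
    (gA : graded A_) (j k : L) (x : A_ j) (y : A_ k) :
  set_val x ** set_val y \in A_ (j `&` k)%O.
Proof.
by case: gA => _ _ _ gM; apply/mem_set/gM; apply/set_mem/valP.
Qed.

Definition graded_mul (R : realType) (d : Order.disp_t)
    (L : meetSemilatticeType d) (A : cstarAlgType R) (A_ : L -> set A)
    (gA : graded A_) (j k : L) (x : A_ j) (y : A_ k) : A_ (j `&` k)%O :=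
  exist _ (set_val x ** set_val y) (graded_mul_subproof gA x y).

(* Main.v *)
Require Import Defs.
From HB Require Import structures.
From mathcomp Require Import all_boot all_order all_algebra.
From mathcomp Require Import complex.
From mathcomp Require Import all_classical all_reals all_analysis.
From mathcomp Require Import lra.

(** Part (a) is multiplicativity of psi.  Everything else rests on two facts on
    star-homomorphisms: they are bounded, and they lift with control of the
    norm (an element of the image of small norm is the image of an element of
    small norm).  The first gives the easy half of (b); the second makes the
    image closed, which is the other half of (b), and makes an injective
    homomorphism bounded below.

    For (c), the point is that injectivity on the dense subalgebra formed by
    the finite sums must pass to the closure.  Linear independence of the
    images and injectivity on each component give injectivity on every finite
    sum.  For a finite subsemilattice F the sum A_F is a sub-C*-algebra, hence
    psi is bounded below on A_F, by a constant that does not depend on F.  An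
    element x of the kernel is a limit of elements y of such sums; psi y is
    small, so y is small, so x is zero.

    That A_F is closed is proved by induction on F: if m is maximal in F, the
    sum J over F minus m is a closed ideal of A_F, and A_F is the sum of A_m
    and J.  Such a sum is closed for the same reason as an image is: it is the
    preimage of the image of A_m modulo J.  Both situations are instances of
    [bounded_lift] and [closed_image_sum], which deal with a homomorphism psi
    on a sub-C*-algebra S, modulo a sub-C*-algebra J that psi(S) multiplies
    into itself.

    The proofs avoid spectral theory.  The only source of norm estimates is
    [rnorm_le1]: if x + cstar x is twice cstar x ** x, then x has norm at most
    1; in other words, 1 - 2x is an isometry in the unitization.
    - Boundedness: a skew-adjoint e of small norm is the skew-adjoint part of
      some c satisfying this relation ([skew_imaginary_part]); psi c satisfies it
      too, so psi e has norm at most 1.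
    - Lifting: for skew-adjoint u the element -u/(1+u) exists and satisfies the
      relation up to sign ([skew_qinv], [rnorm_skew_qinv]), so that, for a real
      s, the element x/(1+sx) has norm at most 1/s, while its image differs
      from psi x by a term of second order in the size of psi x.  This is an
      approximate lift, and iterating gives an exact one ([descent]). *)

Set Implicit Arguments.
Unset Strict Implicit.
Unset Printing Implicit Defensive.

Import Order.TTheory GRing.Theory Num.Theory.
Import numFieldNormedType.Exports.

Local Open Scope classical_set_scope.
Local Open Scope complex_scope.
Local Open Scope ring_scope.

(** * Real-valued norms and successive approximation *)

Section RealNorm.
Variables (R : realType) (V : normedModType R[i]).
Implicit Types (x y z : V) (t : R) (E : set V).

(** The norm of a module over R[i] has its values in R[i], whose order is only
    partial; the estimates below are linear arithmetic in R. *)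
Definition rnorm x : R := complex.Re `|x|.

Lemma rnormE x : `|x| = (rnorm x)%:C.
Proof. by rewrite RRe_real// normr_real. Qed.

Lemma rnorm_ge0 x : 0 <= rnorm x.
Proof. by rewrite -ler0c -rnormE normr_ge0. Qed.

Lemma rnorm0 : rnorm (0 : V) = 0.
Proof. by rewrite /rnorm normr0. Qed.

Lemma rnorm0_eq0 x : rnorm x = 0 -> x = 0.
Proof. by move=> x0; apply/normr0_eq0; rewrite rnormE x0. Qed.

Lemma rnormN x : rnorm (- x) = rnorm x.
Proof. by rewrite /rnorm normrN. Qed.

Lemma rdistC x y : rnorm (x - y) = rnorm (y - x).
Proof. by rewrite /rnorm distrC. Qed.

Lemma ler_rnormD x y : rnorm (x + y) <= rnorm x + rnorm y.
Proof. by rewrite -lecR rmorphD/= -!rnormE ler_normD. Qed.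

Lemma ler_rnormB x y : rnorm (x - y) <= rnorm x + rnorm y.
Proof. by rewrite -(rnormN y) ler_rnormD. Qed.

Lemma ler_rdistD z x y : rnorm (x - y) <= rnorm (x - z) + rnorm (z - y).
Proof. by rewrite -[x - y](subrKA z) ler_rnormD. Qed.

Lemma rnormZ (a : R[i]) x : rnorm (a *: x) = complex.Re `|a| * rnorm x.
Proof.
apply: complexI; rewrite rmorphM/= -!rnormE normrZ.
by congr (_ * _); rewrite -[LHS]RRe_real// normr_real.
Qed.

Lemma rnormZr t x : rnorm (t%:C *: x) = `|t| * rnorm x.
Proof. by rewrite rnormZ normc_def /= expr0n addr0 sqrtr_sqr. Qed.

Lemma rnormZi x : rnorm ('i *: x) = rnorm x.
Proof. by rewrite rnormZ normc_def /= expr0n add0r expr1n sqrtr1 mul1r. Qed.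

Lemma rnorm_small x : (forall e, 0 < e -> rnorm x <= e) -> x = 0.
Proof.
move=> xe; apply: rnorm0_eq0; apply/eqP; rewrite eq_le rnorm_ge0 andbT.
by apply/ler_addgt0Pl => e /xe; rewrite addr0.
Qed.

Lemma nbhs_rnormP x (P : set V) :
  nbhs x P <-> exists2 e : R, 0 < e & forall y, rnorm (x - y) < e -> P y.
Proof.
rewrite -nbhs_nbhs_norm; split=> [[e /= e0 eP]|[e e0 eP]].
  exists (complex.Re e); first by move: e0; rewrite ltcE => /andP[_].
  move=> y xy; apply: eP; rewrite /ball_ /= rnormE -[e]RRe_real ?ltcR//.
  exact: gtr0_real.
by exists e%:C => [|y]; rewrite /ball_ /= ?ltcR// rnormE ltcR => /eP.
Qed.

Lemma closed_approx E x : closed E ->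
  (forall e, 0 < e -> exists2 y, E y & rnorm (x - y) <= e) -> E x.
Proof.
move=> cE xE; apply: cE => B /nbhs_rnormP[e e0 eB].
have [|y Ey xy] := xE (e / 2); first lra.
by exists y; split=> //; apply: eB; lra.
Qed.

Lemma approx_closed E :
  (forall x, (forall e, 0 < e -> exists2 y, E y & rnorm (x - y) <= e) -> E x) ->
  closed E.
Proof.
move=> aE x cx; apply: aE => e e0.
have /cx[y [Ey]] : nbhs x [set y | rnorm (x - y) <= e].
  by apply/nbhs_rnormP; exists e => // y /ltW.
by exists y.
Qed.

Lemma dense_approx E x (e : R) : dense E -> 0 < e ->
  exists2 y, E y & rnorm (x - y) <= e.
Proof.
move=> dE e0; pose ball_e := [set y | rnorm (x - y) <= e].
have [|y [By Ey]] := dE (interior ball_e) _ (open_interior _).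
  by exists x; apply/nbhs_rnormP; exists e => // y /ltW.
by exists y => //; exact: (interior_subset By).
Qed.

End RealNorm.

Lemma half_power_small (R : realType) (a e : R) : 0 < e ->
  exists n, a / 2 ^+ n < e.
Proof.
move=> e0; exists (Num.bound `|a / e|).
rewrite ltr_pdivrMr ?exprn_gt0// mulrC -ltr_pdivrMr//.
apply: (le_lt_trans (ler_norm _)); apply: (lt_trans (archi_boundP _)) => //.
by rewrite -natrX ltr_nat ltn_expl.
Qed.

Section Descent.
Variables (R : realType) (V : completeNormedModType R[i]).

Lemma geometric_cvg (u : nat -> V) (t : R) :
  (forall n, rnorm (u n.+1 - u n) <= t / 2 ^+ n) ->
  exists l, forall n, rnorm (l - u n) <= 2 * t / 2 ^+ n.
Proof.
move=> ut.
have umn n m : rnorm (u (n + m)%N - u n) <= 2 * t / 2 ^+ n - 2 * t / 2 ^+ (n + m).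
  elim: m => [|m IH]; first by rewrite addn0 !subrr rnorm0.
  rewrite addnS; apply: (le_trans (ler_rdistD (u (n + m)%N) _ _)).
  have := ut (n + m)%N; set a := 2 ^+ n in IH *.
  rewrite exprS; set b := 2 ^+ (n + m)%N in IH *.
  have -> : 2 * t / (2 * b) = t / b by rewrite -mulf_div divff ?mul1r.
  have tb : 2 * t / b = 2 * (t / b) by rewrite mulrA.
  rewrite tb in IH; move: (t / b) (2 * t / a) (rnorm _) (rnorm _) IH => p q r v.
  lra.
have t0 : 0 <= t.
  by have := ut 0%N; rewrite expr0 divr1; apply: le_trans; exact: rnorm_ge0.
have p2 n : 0 < 2 ^+ n :> R by rewrite exprn_gt0.
have umn' n m : rnorm (u (n + m)%N - u n) <= 2 * t / 2 ^+ n.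
  apply: (le_trans (umn n m)); rewrite gerBl; apply: divr_ge0; last exact/ltW/p2.
  by rewrite mulr_ge0.
have uc : cauchy (u @ \oo).
  apply: cauchy_exP => e e0.
  have [|n ne] := @half_power_small _ (2 * t) (complex.Re e).
    by move: e0; rewrite ltcE => /andP[_].
  exists (u n); exists n => // k /= nk; rewrite -ball_normE /= rnormE.
  rewrite -[e]RRe_real ?ltcR ?gtr0_real// rdistC -(subnKC nk).
  exact: le_lt_trans (umn' _ _) ne.
move/cauchy_cvgP : uc => /cvg_ex[l ul].
exists l => n; apply/ler_addgt0Pl => e e0.
have [N _ uN] := (iffLR (cvgrPdist_lt _ _) ul) e%:C (etrans (ltcR _ _) e0).
apply: (le_trans (ler_rdistD (u (n + N)%N) _ _)); apply: lerD => //.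
by have := uN _ (leq_addl n N); rewrite /= rnormE ltcR => /ltW.
Qed.

(** Successive approximation.  G x t stands for: the defect of x is at most t.
    If a step of length at most C times the defect halves the defect, the steps
    are summable and the limit has no defect.  The defect is a relation and not
    a function, so that distances to a subspace need no infimum.  It serves
    for fixed points, for exact lifts and for the closedness of sums. *)
Lemma descent (U : set V) (G : V -> R -> Prop) (C K : R) :
  closed U -> 0 <= K ->
  (forall x y t, U x -> U y -> G x t -> G y (t + K * rnorm (x - y))) ->
  (forall x t, U x -> 0 < t -> G x t ->
     exists x', [/\ U x', rnorm (x' - x) <= C * t & G x' (t / 2)]) ->
  forall x t, U x -> 0 < t -> G x t ->
  exists x', [/\ U x', rnorm (x' - x) <= 2 * C * t &
                 forall e, 0 < e -> exists2 s, s <= e & G x' s].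
Proof.
move=> cU K0 GL step x t Ux t0 Gx.
(* Choice asks for a next point at every pair, whence the fallback value 0. *)
have nextP (p : V * R) : exists q, U p.1 -> 0 < p.2 -> G p.1 p.2 ->
    [/\ U q, rnorm (q - p.1) <= C * p.2 & G q (p.2 / 2)].
  have [[Up p0 Gp]|nP] := pselect [/\ U p.1, 0 < p.2 & G p.1 p.2].
    by have [q qP] := step _ _ Up p0 Gp; exists q.
  by exists 0 => ? ? ?; case: nP.
have [next {}nextP] := choice nextP.
pose u := fix u n := if n is n'.+1 then next (u n', t / 2 ^+ n') else x.
have tn n : 0 < t / 2 ^+ n by rewrite divr_gt0 ?exprn_gt0.
have uP n : U (u n) /\ G (u n) (t / 2 ^+ n).
  elim: n => [|n [IH1 IH2]] /=; first by rewrite expr0 divr1.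
  have [/= ? _] := nextP (u n, t / 2 ^+ n) IH1 (tn n) IH2.
  by rewrite exprSr invfM mulrA.
have ud n : rnorm (u n.+1 - u n) <= C * t / 2 ^+ n.
  have [IH1 IH2] := uP n.
  by have [/= _ + _] := nextP (u n, t / 2 ^+ n) IH1 (tn n) IH2; rewrite mulrA.
have [l ul] := geometric_cvg ud.
have Ul : U l.
  apply: closed_approx cU _ => e /(half_power_small (2 * (C * t)))[n /ltW ne].
  by exists (u n); [exact: (uP n).1|exact: le_trans (ul n) ne].
exists l; split => //.
- by have := ul 0%N; rewrite expr0 divr1 mulrA.
- move=> e /(half_power_small (t + K * (2 * (C * t))))[n /ltW ne].
  exists (t / 2 ^+ n + K * rnorm (u n - l)); last first.
    by have [? ?] := uP n; exact: GL.
  apply: le_trans ne; rewrite mulrDl lerD2l -[leRHS]mulrA ler_wpM2l//.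
  by rewrite rdistC ul.
Qed.
End Descent.

(** The defect of x is the distance from f x to x, and the next point is f x. *)
Lemma half_contraction_fixpoint (R : realType) (V : completeNormedModType R[i])
    (U : set V) (f : V -> V) (x0 : V) : closed U -> U x0 ->
  (forall x, U x -> U (f x)) ->
  (forall x y, U x -> U y -> rnorm (f x - f y) <= rnorm (x - y) / 2) ->
  exists2 x, U x & f x = x.
Proof.
move=> cU Ux0 Uf fl.
have [|x y t Ux Uy Gx|x t Ux t0 Gx||||x [Ux _ xP]] :=
  @descent R V U (fun x t => rnorm (f x - x) <= t) 1 2 cU _ _ _ x0
    (rnorm (f x0 - x0) + 1) => //.
- apply: (le_trans (ler_rdistD (f x) _ _)).
  have := ler_rdistD x (f x) y; have := fl _ _ Uy Ux; rewrite (rdistC y).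
  have := rnorm_ge0 (x - y); lra.
- exists (f x); split; [exact: Uf|by rewrite mul1r|].
  by have := fl _ _ (Uf _ Ux) Ux; lra.
- by have := rnorm_ge0 (f x0 - x0); lra.
- by rewrite lerDl.
exists x => //; apply/subr0_eq/rnorm_small => e /xP[s se /le_trans]; exact.
Qed.

(** * Norm estimates in a C*-algebra *)

Section CStarAlgebra.
Variables (R : realType) (A : cstarAlgType R).
Implicit Types (x y z : A) (S : set A).

Lemma cmulr0 x : x ** 0 = 0.
Proof. by rewrite -(scale0r (0 : A)) -cscaleAr !scale0r. Qed.

Lemma cmul0r x : 0 ** x = 0.
Proof. by rewrite -(scale0r (0 : A)) -cscaleAl !scale0r. Qed.

Lemma cmulrN x y : x ** (- y) = - (x ** y).
Proof. by rewrite -scaleN1r -cscaleAr scaleN1r. Qed.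

Lemma cmulNr x y : (- x) ** y = - (x ** y).
Proof. by rewrite -scaleN1r -cscaleAl scaleN1r. Qed.

Lemma cmulBl x y z : (x - y) ** z = x ** z - y ** z.
Proof. by rewrite cmulDl cmulNr. Qed.

Lemma cmulBr x y z : z ** (x - y) = z ** x - z ** y.
Proof. by rewrite cmulDr cmulrN. Qed.

Lemma cstar0 : cstar (0 : A) = 0.
Proof. by rewrite -(scale0r (0 : A)) cstarZ conjC0 !scale0r. Qed.

Lemma cstarN x : cstar (- x) = - cstar x.
Proof. by rewrite -scaleN1r cstarZ rmorphN1 scaleN1r. Qed.

Lemma cstarB x y : cstar (x - y) = cstar x - cstar y.
Proof. by rewrite cstarD cstarN. Qed.

Lemma cstarZr (t : R) x : cstar (t%:C *: x) = t%:C *: cstar x.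
Proof. by rewrite cstarZ conj_Creal// complex_real. Qed.

Lemma cstarZi x : cstar ('i *: x) = - ('i *: cstar x).
Proof.
rewrite cstarZ -scaleNr; congr (_ *: _).
by apply/eqP; rewrite eq_complex /= oppr0 !eqxx.
Qed.

Lemma ler_rnormM x y : rnorm (x ** y) <= rnorm x * rnorm y.
Proof. by rewrite -lecR rmorphM/= -!rnormE normr_cmul. Qed.

Lemma rnorm_cstar_cmul x : rnorm (cstar x ** x) = rnorm x ^+ 2.
Proof. by apply: complexI; rewrite rmorphXn/= -!rnormE normr_cstar_cmul. Qed.

(** The C*-identity and submultiplicativity give one inequality; the other
    follows because the star is an involution. *)
Lemma rnorm_cstar x : rnorm (cstar x) = rnorm x.
Proof.
suff le y : rnorm y <= rnorm (cstar y).
  by apply/eqP; rewrite eq_le -{2}(cstarK x) !le.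
have := ler_rnormM (cstar y) y; rewrite rnorm_cstar_cmul expr2.
have := rnorm_ge0 y; rewrite le_eqVlt => /predU1P[<- _|y0].
  exact: rnorm_ge0.
by rewrite ler_pM2r.
Qed.

Lemma rnormMn2 x : rnorm (x *+ 2) = 2 * rnorm x.
Proof.
by rewrite -scaler_nat -(rmorph_nat (real_complex R)) rnormZr ger0_norm.
Qed.

(** Taking norms, the C*-identity turns the relation into the inequality
    2 r^2 <= 2 r for r the norm of x.  The relation says that 1 - 2x is an
    isometry of the unitization; it is purely algebraic, hence preserved by
    every star-homomorphism. *)
Lemma rnorm_le1 x : x + cstar x = (cstar x ** x) *+ 2 -> rnorm x <= 1.
Proof.
move=> xE; have := ler_rnormD x (cstar x).
rewrite xE rnormMn2 rnorm_cstar_cmul rnorm_cstar => x2.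
have : 0 <= rnorm x by exact: rnorm_ge0.
by rewrite le_eqVlt => /predU1P[<-|] //; nra.
Qed.

(** The product of 1 + x and 1 + y in the unitization is 1 + circ x y, so that
    circ u a = 0 means that 1 + a is a right inverse of 1 + u. *)
Definition circ x y := x + y + x ** y.

Lemma circA x y z : circ x (circ y z) = circ (circ x y) z.
Proof.
rewrite /circ !cmulDl !cmulDr !cmulA !addrA.
by rewrite [LHS](ACl (1*2*5*3*6*4*7))%AC.
Qed.

Lemma circ0r x : circ 0 x = x.
Proof. by rewrite /circ cmul0r add0r addr0. Qed.

Lemma circr0 x : circ x 0 = x.
Proof. by rewrite /circ cmulr0 !addr0. Qed.

(** Formally a = -u/(1+u) and cstar a = u/(1-u), so that both a + cstar a and
    -2 cstar a ** a are equal to 2u^2/(1-u^2): the relation of [rnorm_le1]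
    holds for -a.  The bound does not depend on the size of u. *)
Lemma rnorm_skew_qinv u a : cstar u = - u -> circ u a = 0 -> rnorm a <= 1.
Proof.
move=> su /eqP; rewrite /circ addrAC addr_eq0 => /eqP aE.
have a'E : cstar a = u + cstar a ** u.
  by rewrite -[in LHS](opprK a) -aE cstarN cstarD cstarM su cmulrN -opprD opprK.
rewrite -rnormN; apply: rnorm_le1; rewrite cstarN cmulNr cmulrN opprK mulr2n.
have aE' : a = - (u + u ** a) by rewrite aE opprK.
(* Adding the two expressions of cstar a ** a cancels the cubic terms. *)
have h1 : cstar a ** a = u ** a + cstar a ** u ** a by rewrite {1}a'E cmulDl.
have h2 : cstar a ** a = - (cstar a ** u) - cstar a ** u ** a.
  by rewrite {2}aE' cmulrN cmulDr opprD cmulA.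
rewrite -aE {1}a'E {1}h1 h2 [RHS]addrACA subrr addr0.
by rewrite opprD addrACA subrr add0r.
Qed.

Section SubAlgebra.
Variables (S : set A) (hS : sub_cstar_algebra S).

Lemma subcstar_closed : closed S. Proof. by case: hS. Qed.
Lemma subcstar0 : S 0. Proof. by case: hS => -[]. Qed.
Lemma subcstarD x y : S x -> S y -> S (x + y).
Proof. by case: hS => -[_ + _] _ _ _; apply. Qed.
Lemma subcstarZ (a : R[i]) x : S x -> S (a *: x).
Proof. by case: hS => -[_ _ +] _ _ _; apply. Qed.
Lemma subcstarN x : S x -> S (- x).
Proof. by rewrite -scaleN1r; exact: subcstarZ. Qed.
Lemma subcstarB x y : S x -> S y -> S (x - y).
Proof. by move=> Sx Sy; exact/subcstarD/subcstarN. Qed.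
Lemma subcstarM x y : S x -> S y -> S (x ** y).
Proof. by case: hS => _ + _ _; apply. Qed.
Lemma subcstar_star x : S x -> S (cstar x).
Proof. by case: hS => _ _ + _; apply. Qed.

(** The solution of circ p b = 0 is the fixed point of b |-> -(p + p ** b), a
    contraction that leaves the closed subspace S invariant. *)
Lemma small_qinv p : S p -> rnorm p <= 1 / 2 ->
  exists2 b, S b & circ p b = 0.
Proof.
move=> Sp p2.
have [b Sb bE] : exists2 b, S b & - (p + p ** b) = b.
  apply: (half_contraction_fixpoint subcstar_closed subcstar0)
    => [x Sx|x y Sx Sy].
    exact/subcstarN/subcstarD/subcstarM.
  rewrite opprK addrC opprD addrACA subrr add0r -cmulBr rdistC.
  apply: (le_trans (ler_rnormM _ _)).
  by rewrite rdistC; have := rnorm_ge0 (x - y); nra.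
by exists b => //; rewrite /circ addrAC -[X in _ + X]bE subrr.
Qed.

(** This is the invertibility of 1 + u for skew-adjoint u, that is, the reality
    of the spectrum of a self-adjoint element.  One goes from 0 to u in steps v
    of norm at most 1/4; since every right inverse met on the way has the form
    1 + a with a of norm at most 1, the length of the admissible steps does not
    shrink. *)
Lemma skew_qinv u : S u -> cstar u = - u -> exists2 a, S a & circ u a = 0.
Proof.
move=> Su su; pose n := Num.bound (4 * rnorm u).
have n4 : 4 * rnorm u < n%:R by apply: archi_boundP; rewrite mulr_ge0 ?rnorm_ge0.
have n0 : 0 < n%:R :> R by apply: le_lt_trans n4; rewrite mulr_ge0 ?rnorm_ge0.
pose v := n%:R^-1%:C *: u.
have uv : u = v *+ n.
  rewrite /v -scaler_nat -(rmorph_nat (real_complex R)) scalerA -rmorphM.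
  by rewrite mulfV ?gt_eqF// scale1r.
have Sv : S v by exact: subcstarZ.
have sv : cstar v = - v by rewrite cstarZr su scalerN.
have v4 : rnorm v <= 1 / 4.
  by rewrite rnormZr ger0_norm ?invr_ge0 ?(ltW n0)// ler_pdivrMl//; lra.
rewrite uv; move: v Sv sv v4 {uv n4 n0} => v Sv sv v4; elim: n => [|n [a Sa aE]].
  by exists 0; [exact: subcstar0|rewrite mulr0n circr0].
have a1 : rnorm a <= 1.
  by apply: rnorm_skew_qinv aE; rewrite -scaler_nat cstarZ conjC_nat sv scalerN.
pose p := v + a ** v.
(* 1 + (n+1)v = (1 + nv)(1 + p), because 1 + a is a right inverse of 1 + nv. *)
have pE : circ (v *+ n) p = v *+ n.+1.
  rewrite /circ cmulDr cmulA addrA addrA -(addrA (v *+ n + v)) [a ** v + _]addrC.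
  rewrite -cmulDl -addrA -cmulDl -[X in _ + X ** v]/(circ (v *+ n) a) aE.
  by rewrite cmul0r addr0 -mulrSr.
have Sp : S p by exact/subcstarD/subcstarM.
have [|b Sb bE] := small_qinv Sp.
  apply: (le_trans (ler_rnormD _ _)); have := ler_rnormM a v.
  by have := rnorm_ge0 v; nra.
exists (circ b a); first by apply: subcstarD; [exact: subcstarD|exact: subcstarM].
by rewrite -pE -circA (circA p) bE circ0r.
Qed.
End SubAlgebra.
End CStarAlgebra.

(** * Boundedness of star-homomorphisms *)

Section StarHomContinuity.
Variables (R : realType) (A B : cstarAlgType R) (psi : {starhom A -> B}).

(** With c = p + e, whose adjoint is p - e, the conclusion says that
    cstar c ** c is the real part p of c, the relation of [rnorm_le1].  Since p
    and e will commute, the equation reads p = p^2 - e^2; the map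
    p |-> p^2 - e^2 is a contraction of the set U of self-adjoint elements of
    norm at most 1/4 that commute with e. *)
Lemma skew_imaginary_part (e : A) : cstar e = - e -> rnorm e <= 1 / 4 ->
  exists2 p, cstar p = p & (p - e) ** (p + e) = p.
Proof.
move=> se e4.
pose U := [set p : A | [/\ rnorm p <= 1 / 4, cstar p = p & p ** e = e ** p]].
have cU : closed U.
  apply: approx_closed => x xU; split.
  - apply/ler_addgt0Pl => r /xU[y [y4 _ _] xy].
    by have := ler_rnormD (x - y) y; rewrite subrK; lra.
  - apply/subr0_eq/rnorm_small => r r0.
    have [|y [_ sy _] xy] := xU (r / 2); first lra.
    have := ler_rnormB (cstar (x - y)) (x - y).
    by rewrite rnorm_cstar cstarB sy opprB addrA subrK; lra.
  - apply/subr0_eq/rnorm_small => r /xU[y [_ _ ye] xy].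
    have -> : x ** e - e ** x = (x - y) ** e - e ** (x - y).
      by rewrite cmulBl cmulBr ye opprB addrA subrK.
    apply: (le_trans (ler_rnormB _ _)).
    have := ler_rnormM (x - y) e; have := ler_rnormM e (x - y).
    have := rnorm_ge0 e; have := rnorm_ge0 (x - y).
    by nra.
have U0 : U 0.
  by rewrite /U/= rnorm0 cstar0 cmul0r cmulr0; split=> //; lra.
have [x [x4 sx xe]|x y [x4 sx xe] [y4 sy ye]|p [_ sp pe] pE] :=
    half_contraction_fixpoint (f := fun p => p ** p - e ** e) cU U0.
- split.
  + apply: (le_trans (ler_rnormB _ _)).
    have := ler_rnormM x x; have := ler_rnormM e e.
    by have := rnorm_ge0 e; have := rnorm_ge0 x; nra.
  + by rewrite cstarB !cstarM sx se cmulNr cmulrN opprK.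
  + by rewrite cmulBl cmulBr -cmulA xe cmulA xe !cmulA.
- rewrite opprB addrA subrK.
  have -> : x ** x - y ** y = x ** (x - y) + (x - y) ** y.
    by rewrite cmulBl cmulBr addrA subrK.
  apply: (le_trans (ler_rnormD _ _)).
  have := ler_rnormM x (x - y); have := ler_rnormM (x - y) y.
  by have := rnorm_ge0 (x - y); nra.
exists p => //; rewrite cmulBl !cmulDr pe -addrA opprD addNKr.
exact: pE.
Qed.

Lemma starhom_skew_le1 (e : A) : cstar e = - e -> rnorm e <= 1 / 4 ->
  rnorm (psi e) <= 1.
Proof.
move=> se /(skew_imaginary_part se)[p sp pE].
have sc : cstar (p + e) = p - e by rewrite cstarD sp se.
have c1 : rnorm (psi (p + e)) <= 1.
  apply: rnorm_le1; rewrite -!starhom_star -!starhomM -raddfD -raddfMn sc pE.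
  by rewrite addrACA subrr addr0.
have := ler_rnormB (psi (p + e)) (cstar (psi (p + e))).
rewrite rnorm_cstar -starhom_star sc -raddfB.
have -> : p + e - (p - e) = e *+ 2 by rewrite opprB addrC subrKA mulr2n.
by rewrite raddfMn/= rnormMn2; lra.
Qed.

Lemma starhom_skew_bound (e : A) : cstar e = - e ->
  rnorm (psi e) <= 4 * rnorm e.
Proof.
move=> se; have := rnorm_ge0 e; rewrite le_eqVlt => /predU1P[e0|e0].
  by rewrite -e0 (rnorm0_eq0 (esym e0)) raddf0 rnorm0 mulr0.
have t0 : 0 < (4 * rnorm e)^-1 by rewrite invr_gt0 mulr_gt0.
have := @starhom_skew_le1 ((4 * rnorm e)^-1%:C *: e).
rewrite cstarZr se scalerN => /(_ erefl).
rewrite (linearZ_LR psi) !rnormZr ger0_norm ?(ltW t0)//.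
by rewrite !ler_pdivrMl ?mulr_gt0// mulr1; apply; lra.
Qed.

(** The element cstar x ** x has norm the square of that of x and becomes
    skew-adjoint when multiplied by 'i. *)
Lemma starhom_bound (x : A) : rnorm (psi x) <= 2 * rnorm x.
Proof.
have := @starhom_skew_bound ('i *: (cstar x ** x)).
rewrite cstarZi cstarM cstarK (linearZ_LR psi)/= !rnormZi starhomM starhom_star.
rewrite !rnorm_cstar_cmul => /(_ erefl).
have := rnorm_ge0 x; have := rnorm_ge0 (psi x); nra.
Qed.

End StarHomContinuity.

(** * Lifting along a star-homomorphism, modulo an ideal *)

Section BoundedLifting.
Variables (R : realType) (A B : cstarAlgType R) (psi : {starhom A -> B}).
(* With J = 0 this is about the image of S; with psi the identity and J an ideal
   of S + J, it is about the quotient by J. *)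
Variables (S : set A) (J : set B).
Hypotheses (hS : sub_cstar_algebra S) (hJ : sub_cstar_algebra J).
Hypothesis SJ : forall x z, S x -> J z -> J (psi x ** z).

Let JS x z : S x -> J z -> J (z ** psi x).
Proof.
move=> Sx Jz; rewrite -(cstarK z) -(cstarK (psi x)) -cstarM.
apply: (subcstar_star hJ); rewrite -starhom_star.
by apply: SJ; [exact: (subcstar_star hS)|exact: (subcstar_star hJ)].
Qed.

(** The quotient seminorm of psi x modulo J, as a relation that avoids the
    infimum.  It satisfies the rules of a submultiplicative star-invariant
    seminorm bounded by a multiple of the norm, and these rules are all that
    the lifting argument uses. *)
Definition dist_le (x : A) (t : R) := exists2 z, J z & rnorm (psi x + z) <= t.

Lemma dist_leW x t u : t <= u -> dist_le x t -> dist_le x u.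
Proof. by move=> tu [z Jz zt]; exists z => //; exact: le_trans tu. Qed.

Lemma dist_le_bound x : dist_le x (2 * rnorm x).
Proof. by exists 0; [exact: subcstar0 hJ|rewrite addr0 starhom_bound]. Qed.

Lemma dist_leD x y t u : dist_le x t -> dist_le y u -> dist_le (x + y) (t + u).
Proof.
move=> [z Jz zt] [w Jw wu]; exists (z + w); first exact: subcstarD.
rewrite raddfD addrACA; apply: (le_trans (ler_rnormD _ _)); exact: lerD.
Qed.

Lemma dist_leZ (a : R[i]) x t : dist_le x t ->
  dist_le (a *: x) (complex.Re `|a| * t).
Proof.
move=> [z Jz zt]; exists (a *: z); first exact: subcstarZ.
rewrite (linearZ_LR psi) -scalerDr rnormZ ler_wpM2l//.
by rewrite -ler0c RRe_real ?normr_real.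
Qed.

Lemma dist_leZr (a : R) x t : dist_le x t -> dist_le (a%:C *: x) (`|a| * t).
Proof.
by move/(dist_leZ a%:C); rewrite normc_def /= expr0n addr0 sqrtr_sqr.
Qed.

Lemma dist_leZi x t : dist_le x t -> dist_le ('i *: x) t.
Proof.
by move/(dist_leZ 'i); rewrite normc_def /= expr0n add0r expr1n sqrtr1 mul1r.
Qed.

Lemma dist_leN x t : dist_le x t -> dist_le (- x) t.
Proof.
move=> [z Jz zt]; exists (- z); first exact: subcstarN.
by rewrite raddfN -opprD rnormN.
Qed.

Lemma dist_le_star x t : dist_le x t -> dist_le (cstar x) t.
Proof.
move=> [z Jz zt]; exists (cstar z); first exact: subcstar_star.
by rewrite starhom_star -cstarD rnorm_cstar.
Qed.

Lemma dist_leM x y t u : S x -> S y ->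
  dist_le x t -> dist_le y u -> dist_le (x ** y) (t * u).
Proof.
move=> Sx Sy [z Jz zt] [w Jw wu].
exists (psi x ** w + (z ** psi y + z ** w)).
  apply: subcstarD => //; first exact: SJ.
  by apply: subcstarD => //; [exact: JS|exact: subcstarM].
rewrite starhomM -cmulDr addrA -cmulDr -cmulDl.
apply: (le_trans (ler_rnormM _ _)).
by apply: ler_pM => //; exact: rnorm_ge0.
Qed.

(** The lift is x' = x/(1+sx), with s a small multiple of 1/t.  By
    [rnorm_skew_qinv] its norm is at most 1/s, whatever the norm of x; and
    x - x' is, up to sign, the product of x by a = -sx/(1+sx), whose seminorm is
    at most 3st because a = -s(x + xa) and a itself has seminorm at most 2. *)
Lemma skew_almost_lift x t : S x -> cstar x = - x -> 0 < t -> dist_le x t ->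
  exists x', [/\ S x', rnorm x' <= 12 * t & dist_le (x - x') (t / 4)].
Proof.
move=> Sx sx t0 xt.
(* The defect t * (3 * (s * t)) is then t / 4. *)
pose s := (12 * t)^-1.
have s0 : 0 < s by rewrite invr_gt0 mulr_gt0.
have Su : S (s%:C *: x) by exact: subcstarZ.
have su : cstar (s%:C *: x) = - (s%:C *: x) by rewrite cstarZr sx scalerN.
have [a Sa aE] := skew_qinv hS Su su.
have a1 := rnorm_skew_qinv su aE.
have a2 : dist_le a 2.
  by apply: dist_leW (dist_le_bound a); lra.
have {}aE : - a = s%:C *: (x + x ** a).
  move/eqP: aE; rewrite /circ addrAC addr_eq0 => /eqP <-.
  by rewrite scalerDr cscaleAl.
have a3 : dist_le a (3 * (s * t)).
  rewrite -(opprK a) aE; apply: dist_leN.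
  have -> : 3 * (s * t) = `|s| * (t + t * 2) by rewrite gtr0_norm//; lra.
  by apply: dist_leZr; apply: dist_leD => //; exact: dist_leM.
exists (x + x ** a); split.
- by apply: (subcstarD hS) => //; exact: (subcstarM hS).
- have -> : x + x ** a = (12 * t)%:C *: - a.
    rewrite aE scalerA -rmorphM mulfV ?scale1r// gt_eqF//.
    by rewrite mulr_gt0.
  by rewrite rnormZr rnormN gtr0_norm ?mulr_gt0//; nra.
- rewrite opprD addNKr; apply: dist_leN.
  apply: dist_leW (dist_leM Sx Sa xt a3).
  have -> : s * t = 12^-1.
    by rewrite /s invfM -mulrA mulVf ?mulr1// gt_eqF.
  lra.
Qed.

(** Every element is x1 - 'i x2 with x1 and x2 skew-adjoint; each of the two
    parts leaves a defect of t / 4. *)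
Lemma almost_lift x t : S x -> 0 < t -> dist_le x t ->
  exists x', [/\ S x', rnorm x' <= 24 * t & dist_le (x - x') (t / 2)].
Proof.
move=> Sx t0 xt; have Ssx := subcstar_star hS Sx; have sxt := dist_le_star xt.
pose x1 := 2^-1%:C *: (x - cstar x); pose x2 := 2^-1%:C *: ('i *: (x + cstar x)).
have h2 : `|2^-1| * (t + t) = t by rewrite gtr0_norm//; lra.
have [||||y1 [Sy1 y1t d1]] := @skew_almost_lift x1 t => //.
- by apply: (subcstarZ hS); exact: (subcstarB hS).
- by rewrite cstarZr cstarB cstarK -scalerN opprB.
- by rewrite -h2; apply: dist_leZr; apply: dist_leD => //; exact: dist_leN.
have [||||y2 [Sy2 y2t d2]] := @skew_almost_lift x2 t => //.
- by do 2![apply: (subcstarZ hS)]; exact: (subcstarD hS).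
- by rewrite /x2 cstarZr cstarZi cstarD cstarK scalerN [cstar x + _]addrC.
- by rewrite -h2; apply: dist_leZr; apply: dist_leZi; exact: dist_leD.
exists (y1 - 'i *: y2); split.
- by apply: (subcstarB hS) => //; exact: (subcstarZ hS).
- by have := ler_rnormB y1 ('i *: y2); rewrite rnormZi; lra.
have xE : x = x1 - 'i *: x2.
  have -> : 'i *: x2 = - (2^-1%:C *: (x + cstar x)).
    by rewrite /x2 !scalerA mulrAC -expr2 sqr_i mulN1r scaleNr.
  rewrite opprK -scalerDr addrACA addNr addr0 scalerDr -scalerDl -rmorphD.
  have -> : 2^-1 + 2^-1 = 1 :> R by lra.
  by rewrite scale1r.
have -> : x - (y1 - 'i *: y2) = (x1 - y1) - 'i *: (x2 - y2).
  by rewrite [in LHS]xE scalerBr !opprB addrACA [RHS]addrACA [- y1 + _]addrC.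
have -> : t / 2 = t / 4 + t / 4 by lra.
by apply: dist_leD => //; apply: dist_leN; exact: dist_leZi.
Qed.

(** The defect of a candidate y is the seminorm of x - y; [almost_lift] applied
    to x - y corrects y at a cost of 24 times the defect. *)
Lemma bounded_lift x t : S x -> 0 < t -> dist_le x t ->
  exists x', [/\ S x', rnorm x' <= 48 * t & J (psi (x - x'))].
Proof.
move=> Sx t0 xt.
have [|y z u _ _ yu|y u Sy u0 yu||||x' [Sx' x't x'J]] :=
  @descent R A S (fun y u => dist_le (x - y) u) 24 2 (subcstar_closed hS)
   _ _ _ 0 t => //.
- have -> : x - z = (x - y) + (y - z) by rewrite subrKA.
  by apply: dist_leD => //; exact: dist_le_bound.
- have [w [Sw wu dw]] := almost_lift (subcstarB hS Sx Sy) u0 yu.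
  exists (y + w); split; first exact: (subcstarD hS).
    by rewrite addrC addKr.
  by rewrite opprD addrA.
- exact: (subcstar0 hS).
- by rewrite subr0.
exists x'; split=> //; first by move: x't; rewrite subr0; lra.
apply: closed_approx (subcstar_closed hJ) _ => e /x'J[s se [z Jz zs]].
exists (- z); first exact: (subcstarN hJ).
by rewrite opprK; exact: le_trans se.
Qed.

(** An element b of the closure is approached by successive corrections: the
    difference between two approximations of b modulo J is small, hence, by
    [bounded_lift], the image modulo J of a small element of S. *)
Lemma closed_image_sum :
  closed [set b | exists x z, [/\ S x, J z & b = psi x + z]].
Proof.
apply: approx_closed => b bE.
pose G x t := exists2 z, J z & rnorm (b - psi x - z) <= t.
have [_ [x0 [z0 [Sx0 Jz0 ->]]] b0] := bE 1 ltr01.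
have [|x y t _ _ [z Jz zt]|x t Sx t0 [z Jz zt]||||x [Sx _ xJ]] :=
  @descent R A S G 72 2 (subcstar_closed hS) _ _ _ x0 1 => //.
- exists z => //; have -> : b - psi y - z = b - psi x - z + psi (x - y).
    by rewrite raddfB [RHS]addrAC subrKA.
  have := starhom_bound psi (x - y).
  by have := ler_rnormD (b - psi x - z) (psi (x - y)); lra.
(* Any y closer to b than x is would halve the defect, but may be far from x;
   it is replaced by x + v, where v is a bounded lift of psi (y - x). *)
- have [|_ [y [w [Sy Jw ->]]] bw] := bE (t / 2); first lra.
  have yx : dist_le (y - x) (3 / 2 * t).
    exists (w - z); first exact: (subcstarB hJ).
    have -> : psi (y - x) + (w - z) = b - psi x - z - (b - (psi y + w)).
      by rewrite raddfB opprB [RHS]addrC -[b - psi x - z]addrA subrKA addrACA.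
    by have := ler_rnormB (b - psi x - z) (b - (psi y + w)); lra.
  have [|v [Sv vt dv]] := bounded_lift (subcstarB hS Sy Sx) _ yx; first lra.
  exists (x + v); split; first exact: (subcstarD hS).
    by rewrite addrC addKr; lra.
  exists (w + psi (y - x - v)); first exact: (subcstarD hJ).
  have -> : b - psi (x + v) - (w + psi (y - x - v)) = b - (psi y + w).
    rewrite -(addrA y) -opprD raddfB/= -addrA -opprD addrA [_ + w + _]addrC.
    by rewrite subrKA.
  exact: bw.
- by exists z0 => //; rewrite -addrA -opprD.
exists x, (b - psi x); split => //; last by rewrite addrC subrK.
apply: closed_approx (subcstar_closed hJ) _ => e /xJ[s se [z Jz zs]].
by exists z => //; exact: le_trans se.
Qed.

End BoundedLifting.

(** * Finite sums of components *)

Section IdStarHom.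
Variables (R : realType) (A : cstarAlgType R).
Fact idfun_starhomM : {morph @idfun A : x y / x ** y}. Proof. by []. Qed.
Fact idfun_starhom_star : {morph @idfun A : x / cstar x}. Proof. by []. Qed.
HB.instance Definition _ := isStarMultiplicative.Build R A A (@idfun A)
  idfun_starhomM idfun_starhom_star.
End IdStarHom.

Lemma sub_cstar_algebra0 (R : realType) (A : cstarAlgType R) :
  sub_cstar_algebra [set (0 : A)].
Proof.
split=> [|x y -> ->|x ->|].
- by split=> [|x y -> ->|a x ->] //=; rewrite ?addr0 ?scaler0.
- by rewrite /= cmulr0.
- by rewrite /= cstar0.
- apply: approx_closed => x x0; apply: rnorm_small => e /x0[_ ->].
  by rewrite subr0.
Qed.

Lemma sub_cstar_algebraT (R : realType) (A : cstarAlgType R) :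
  sub_cstar_algebra [set: A].
Proof. by split=> //; exact: closedT. Qed.

Section AlgebraicSum.
Variables (K : numFieldType) (V : lmodType K) (I : choiceType) (E : I -> set V).
Hypothesis hE : forall i, linear_subspace (E i).
Implicit Types (F G : set I) (W : set V).

Lemma subspace_fsum W F (s : I -> V) : linear_subspace W -> finite_set F ->
  (forall i, F i -> W (s i)) -> W (\sum_(i \in F) s i).
Proof.
move=> [W0 WD _] fF Ws; rewrite fsbig_finite// big_seq.
by apply: (big_ind W) => // i; rewrite in_fset_set// inE => /Ws.
Qed.

Lemma algebraic_sum_min W F : linear_subspace W -> finite_set F ->
  (forall i, F i -> E i `<=` W) -> algebraic_sum E F `<=` W.
Proof.
move=> hW fF EW _ [s [Es _ ->]]; apply: subspace_fsum => // i Fi.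
exact: EW (Es _ Fi).
Qed.

Lemma algebraic_sum_subspace F : finite_set F ->
  linear_subspace (algebraic_sum E F).
Proof.
move=> fF; split.
- exists (fun=> 0); split=> [i _||]; [by case: (hE i)|exact: finite_setIl|].
  by rewrite fsbig1.
- move=> _ _ [s [Es _ ->]] [t [Et _ ->]]; exists (fun i => s i + t i).
  split=> [i Fi||]; [|exact: finite_setIl|by rewrite fsbig_split].
  by case: (hE i) => _ + _; apply; [exact: Es|exact: Et].
- move=> a _ [s [Es _ ->]]; exists (fun i => a *: s i).
  split=> [i Fi||]; [|exact: finite_setIl|by rewrite !fsbig_finite// scaler_sumr].
  by case: (hE i) => _ _; apply; exact: Es.
Qed.

Lemma algebraic_sum_sup F i : finite_set F -> F i -> E i `<=` algebraic_sum E F.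
Proof.
move=> fF Fi x Ex; exists (fun j => if j == i then x else 0); split.
- by move=> j _; case: eqP => [->//|_]; case: (hE j).
- exact: finite_setIl.
- rewrite (fsbigD1 i)//= eqxx fsbig1 ?addr0// => j [_ /eqP ji].
  by rewrite (negPf ji).
Qed.

Lemma algebraic_sumS F G : finite_set F -> finite_set G -> F `<=` G ->
  algebraic_sum E F `<=` algebraic_sum E G.
Proof.
move=> fF fG FG; apply: algebraic_sum_min => //.
  exact: algebraic_sum_subspace.
by move=> i /FG; exact: algebraic_sum_sup.
Qed.

End AlgebraicSum.

Lemma linear_span_subspace (K : numFieldType) (V : lmodType K) (E : set V) :
  linear_subspace (linear_span E).
Proof.
split=> [W [[]]//|x y Ex Ey W WE|a x Ex W WE].
  by have [[_ + _] _] := WE; apply; [exact: Ex|exact: Ey].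
by have [[_ _ +] _] := WE; apply; exact: Ex.
Qed.

Section Semilattice.
Variables (d : Order.disp_t) (L : meetSemilatticeType d).

Lemma seq_maximal (s : seq L) : s != [::] ->
  exists2 m, m \in s & forall i, i \in s -> (m <= i)%O -> i = m.
Proof.
elim: s => // x s IH _; have [->|/IH[m ms mmax]] := eqVneq s [::].
  by exists x => [|i]; rewrite mem_seq1 ?eqxx// => /eqP.
have [mx|mx] := boolP (m <= x)%O; last first.
  exists m; first by rewrite inE ms orbT.
  by move=> i; rewrite inE => /predU1P[-> xm|/mmax//]; rewrite xm in mx.
exists x; first by rewrite inE eqxx.
move=> i; rewrite inE => /predU1P[//|si] xi.
have im := mmax _ si (le_trans mx xi).
by apply/eqP; rewrite eq_le xi andbT im.
Qed.

(** Adding one element a to a finite subsemilattice G adds only a and the meets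
    of a with the elements of G. *)
Lemma finite_subsemilattice (F : set L) : finite_set F ->
  exists G, [/\ finite_set G, subsemilattice G & F `<=` G].
Proof.
move=> /finite_seqP[s ->]; elim: s => [|a s [G [fG sG FG]]].
  by exists set0; split=> // i j [].
exists (G `|` ([set a] `|` (fun g => a `&` g)%O @` G)); split.
- rewrite !finite_setU; split => //; split; first exact: finite_set1.
  exact: finite_image.
- move=> i j [Gi|[->|[g Gg <-]]] [Gj|[->|[h Gh <-]]].
  + by left; exact: sG.
  + by right; right; exists i => //; rewrite meetC.
  + by right; right; exists (i `&` h)%O; [exact: sG|rewrite meetCA].
  + by right; right; exists j.
  + by right; left; rewrite meetxx.
  + by right; right; exists h => //; rewrite meetA meetxx.
  + by right; right; exists (g `&` j)%O; [exact: sG|rewrite meetA].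
  + by right; right; exists g => //; rewrite meetAC meetxx.
  + right; right; exists (g `&` h)%O; first exact: sG.
    by rewrite meetACA meetxx.
- by move=> i /=; rewrite inE => /predU1P[->|/FG]; [right; left|left].
Qed.

End Semilattice.

Section Graded.
Variables (R : realType) (d : Order.disp_t) (L : meetSemilatticeType d).
Variables (A : cstarAlgType R) (A_ : L -> set A).
Hypothesis gA : graded A_.

Lemma graded_sub i : sub_cstar_algebra (A_ i). Proof. by case: gA. Qed.

Lemma graded_subspace i : linear_subspace (A_ i).
Proof. by case: (graded_sub i). Qed.

Lemma graded_cmul i j x y : A_ i x -> A_ j y -> A_ (i `&` j)%O (x ** y).
Proof. by case: gA => _ _ _; apply. Qed.

Lemma closed_algebraic_sum_sub (F : set L) : finite_set F -> subsemilattice F ->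
  closed (algebraic_sum A_ F) -> sub_cstar_algebra (algebraic_sum A_ F).
Proof.
move=> fF sF cF; have sub := algebraic_sum_subspace graded_subspace fF.
have [S0 SD SZ] := sub.
split=> // [x y Sx Sy|].
  pose W := [set x | algebraic_sum A_ F (x ** y)].
  suff sW : algebraic_sum A_ F `<=` W by exact: sW.
  apply: algebraic_sum_min => // [|i Fi x' Ax].
    split=> [|x1 x2|a x1]; rewrite /W/=.
    - by rewrite cmul0r.
    - by rewrite cmulDl; exact: SD.
    - by rewrite -cscaleAl; exact: SZ.
  pose W' := [set y | algebraic_sum A_ F (x' ** y)].
  suff sW' : algebraic_sum A_ F `<=` W' by exact: sW'.
  apply: algebraic_sum_min => // [|j Fj z Az].
    split=> [|x1 x2|a x1]; rewrite /W'/=.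
    - by rewrite cmulr0.
    - by rewrite cmulDr; exact: SD.
    - by rewrite -cscaleAr; exact: SZ.
  apply: (@algebraic_sum_sup _ _ _ _ graded_subspace _ (i `&` j)%O) => //.
    exact: sF.
  exact: graded_cmul.
apply: algebraic_sum_min => // [|i Fi x Ax].
  split=> [|x1 x2|a x1] /=.
  - by rewrite cstar0.
  - by rewrite cstarD; exact: SD.
  - by rewrite cstarZ; exact: SZ.
apply: (@algebraic_sum_sup _ _ _ _ graded_subspace _ i) => //.
exact: subcstar_star (graded_sub i) _ Ax.
Qed.

(** Removing a maximal element m from F leaves an ideal J of A_F, since
    a meet m `&` j equal to m would force m <= j.  By induction J is closed, and
    then A_F = A_m + J is closed by [closed_image_sum]. *)
Lemma algebraic_sum_sub_cstar_algebra (F : set L) :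
  finite_set F -> subsemilattice F -> sub_cstar_algebra (algebraic_sum A_ F).
Proof.
move=> fF sF; apply: closed_algebraic_sum_sub => //.
case/finite_seqP: fF => s Fs; have [n] := ubnP (size s).
elim: n => // n IH in s F Fs sF *; rewrite ltnS => sn.
have [s0|/seq_maximal[m ms mmax]] := eqVneq s [::].
  have -> : algebraic_sum A_ F = [set 0].
    apply/seteqP; rewrite Fs s0 set_nil; split=> [_ [t [_ _ ->]]|_ ->].
      by rewrite fsbig_set0.
    by exists (fun=> 0); split=> //; [exact: finite_setIl|rewrite fsbig_set0].
  exact: subcstar_closed (sub_cstar_algebra0 A).
pose F' := [set` [seq i <- s | i != m]].
have FF' : F' = F `\ m.
  apply/seteqP; split=> i; rewrite /F' Fs /= mem_filter.
    by case/andP=> /eqP im si; split.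
  by case=> si /eqP im; rewrite im.
have fF' : finite_set F' by exact: finite_seq.
have sF' : subsemilattice F'.
  rewrite FF' => i j [Fi im] [Fj _]; split; first exact: sF.
  move=> ijm; apply: im; apply: mmax; first by rewrite Fs in Fi.
  by rewrite -ijm leIl.
have fF : finite_set F by rewrite Fs; exact: finite_seq.
have Fm : F m by rewrite Fs.
have hJ : sub_cstar_algebra (algebraic_sum A_ F').
  apply: closed_algebraic_sum_sub => //; apply: IH erefl sF' _.
  rewrite size_filter (leq_trans _ sn)// -(count_predC (pred1 m)) -[ltnLHS]add0n.
  by rewrite ltn_add2r -has_count has_pred1.
have hJm x z : A_ m x -> algebraic_sum A_ F' z ->
    algebraic_sum A_ F' (idfun x ** z).
  move=> Ax; pose W := [set z | algebraic_sum A_ F' (x ** z)].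
  suff sW : algebraic_sum A_ F' `<=` W by exact: sW.
  apply: algebraic_sum_min => // [|j].
    split=> [|x1 x2|a x1]; rewrite /W/=.
    - by rewrite cmulr0; exact: subcstar0 hJ.
    - by rewrite cmulDr; exact: subcstarD.
    - by rewrite -cscaleAr; exact: subcstarZ.
  rewrite {1}FF' => -[Fj jm] y Ay; rewrite /W/=.
  apply: (@algebraic_sum_sup _ _ _ _ graded_subspace _ (m `&` j)%O) => //.
    rewrite FF'; split; first exact: sF.
    by move=> mj; apply: jm; apply: mmax; [rewrite Fs in Fj|rewrite -mj leIr].
  exact: graded_cmul.
have := @closed_image_sum R A A idfun _ _ (graded_sub m) hJ hJm.
congr closed; apply/seteqP; split=> [_ [x [z [Ax Jz ->]]]|_ [t [At _ ->]]].
  have [_ SD _] := algebraic_sum_subspace graded_subspace fF.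
  apply: SD; first exact: (algebraic_sum_sup graded_subspace fF Fm).
  by apply: algebraic_sumS Jz => //; [exact: graded_subspace|rewrite FF' => ? []].
rewrite (fsbigD1 m)//=; exists (t m), (\sum_(j \in F `\ m) t j); split=> //.
  exact: At.
rewrite FF'; exists t; split=> // [i [Fi _]|]; first exact: At.
by apply: finite_setIl; rewrite -FF'.
Qed.

(** The subspaces A_F are directed, because two finite subsemilattices lie in a
    third one. *)
Lemma linear_span_graded x : linear_span (\bigcup_i A_ i) x ->
  exists F, [/\ finite_set F, subsemilattice F & algebraic_sum A_ F x].
Proof.
move=> /(_ [set x | exists F, [/\ finite_set F, subsemilattice F &
  algebraic_sum A_ F x]]); apply; split; last first.
  move=> y [i _ Ay]; exists [set i]; split; first exact: finite_set1.
    by move=> _ _ -> ->; rewrite /= meetxx.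
  by rewrite algebraic_sum1.
split=> [|y z [F [fF sF Fy]] [G [fG sG Gz]]|a y [F [fF sF Fy]]].
- exists set0; split=> //.
  by have [S0 _ _] := algebraic_sum_subspace graded_subspace (finite_set0 L);
    exact: S0.
- have [|H [fH sH FGH]] := @finite_subsemilattice _ _ (F `|` G).
    by rewrite finite_setU.
  exists H; split=> //; have [_ + _] := algebraic_sum_subspace graded_subspace fH.
  by apply; [move: Fy|move: Gz]; apply: algebraic_sumS => //;
    try exact: graded_subspace; move=> i ?; apply: FGH; [left|right].
- exists F; split=> //; have [_ _ +] := algebraic_sum_subspace graded_subspace fF.
  exact.
Qed.

End Graded.

(** * Surjectivity and injectivity *)

Lemma range_sigL (T U : Type) (E : set T) (f : T -> U) :
  range (sigL E f) = f @` E.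
Proof.
apply/seteqP; split=> _ [x Ex <-].
  by exists (set_val x) => //; exact/set_mem/valP.
by exists (SigSub (mem_set Ex)) => //; rewrite sigLE.
Qed.

Section StarHomGraded.
Variables (R : realType) (d : Order.disp_t) (L : meetSemilatticeType d).
Variables (A : cstarAlgType R) (A_ : L -> set A) (B : cstarAlgType R).
Hypothesis gA : graded A_.
Variable psi : {starhom A -> B}.

Lemma starhom_continuous : continuous psi.
Proof.
move=> x P /nbhs_rnormP[e e0 eP]; apply/nbhs_rnormP.
exists (e / 2) => [|y xy]; first lra.
by apply: eP; rewrite -raddfB; have := starhom_bound psi (x - y); lra.
Qed.

(** A continuous surjection has dense image on a dense subset, and psi maps the
    span of the components into the span of their images. *)
Lemma surjective_total :
  set_surj [set: A] [set: B] psi -> total_family (fun i => psi @` A_ i).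
Proof.
move=> psiS O [b Ob] oO; have [a _ ab] := psiS b I.
have [_ _ tA _] := gA.
have [||x [Ox xA]] := tA (psi @^-1` O).
- by exists a; rewrite /= ab.
- by apply: open_comp oO => y _; exact: starhom_continuous.
exists (psi x); split=> //.
have [S0 SD SZ] := linear_span_subspace (\bigcup_i (psi @` A_ i)).
apply: (xA [set x | linear_span (\bigcup_i (psi @` A_ i)) (psi x)]).
split; first split=> [|y z|c y] /=.
- by rewrite raddf0.
- by rewrite raddfD; exact: SD.
- by rewrite (linearZ_LR psi); exact: SZ.
- by move=> y [i _ Ay] W [_]; apply; exists i => //; exists y.
Qed.

Lemma closed_range : closed (range psi).
Proof.
have := @closed_image_sum _ _ _ psi _ _ (sub_cstar_algebraT A)
  (sub_cstar_algebra0 B).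
rewrite (_ : [set b | _] = range psi); last first.
  apply/seteqP; split=> [_ [x [_ [_ -> ->]]]|_ [x _ <-]].
    by exists x => //; rewrite addr0.
  by exists x, 0; split=> //; rewrite addr0.
by apply=> x _ _ ->; rewrite cmulr0.
Qed.

(** The range is a closed subspace that contains a dense span. *)
Lemma total_surjective :
  total_family (fun i => psi @` A_ i) -> set_surj [set: A] [set: B] psi.
Proof.
move=> tB b _; apply: closed_approx closed_range _ => e e0.
have [y By bye] := dense_approx b tB e0; exists y => //.
apply: By; split=> [|_ [i _ [x Ax <-]]]; last by exists x.
split=> [|_ _ [x _ <-] [z _ <-]|a _ [x _ <-]].
- by exists 0 => //; rewrite raddf0.
- by exists (x + z) => //; rewrite raddfD.
- by exists (a *: x) => //; rewrite (linearZ_LR psi).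
Qed.

(** A vanishing finite sum of elements psi (t i) is the image of the sum of the
    t i over a finite subsemilattice that contains the support. *)
Lemma injective_on_sums_independent :
  (forall F : set L, finite_set F -> subsemilattice F ->
    {in algebraic_sum A_ F &, injective psi}) ->
  linearly_independent (fun i => psi @` A_ i).
Proof.
move=> psiI s sE fs s0 i.
have /choice[t tP] j : exists x, A_ j x /\ psi x = s j.
  by have [x Ax xs] := sE j; exists x.
have [G [fG sG XG]] := finite_subsemilattice fs.
have [//|si] := eqVneq (s i) 0.
have Gi : G i by exact: XG.
have hG := algebraic_sum_sub_cstar_algebra gA fG sG.
have tG0 : \sum_(j \in G) t j = 0.
  apply: (psiI _ fG sG); rewrite ?inE; [|exact: subcstar0 hG|].
    by exists t; split=> // [j _|]; [case: (tP j)|exact: finite_setIl].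
  rewrite raddf0 fsbig_finite// raddf_sum -fsbig_finite//= -[RHS]s0.
  rewrite (eq_fsbigr s) => [|j _]; last by case: (tP j).
  apply: fsbig_widen => // j [_ Gj] /=.
  by have [//|sj] := eqVneq (s j) 0; case: Gj; exact: XG.
pose t' := patch (fun=> 0) G t.
have [_ indA _ _] := gA.
have t'0 : forall j, t' j = 0.
  apply: indA => [j||].
  - rewrite /t' /patch; case: ifP => _; first by case: (tP j).
    exact: subcstar0 (graded_sub gA j).
  - apply: sub_finite_set fG => j /=; rewrite /t' /patch.
    by case: ifPn => [/set_mem//|_]; rewrite eqxx.
  - by rewrite -fsbig_mkcond.
have := t'0 i; rewrite /t' /patch mem_set// => ti0.
by have [_ <-] := tP i; rewrite ti0 raddf0.
Qed.

(** Approximating an element of the kernel by elements y of finite sums, where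
    psi is injective and therefore bounded below. *)
Lemma independent_injective :
  (forall i, {in A_ i &, injective psi}) ->
  linearly_independent (fun i => psi @` A_ i) -> injective psi.
Proof.
move=> inj ind.
have ker0 F x : finite_set F -> algebraic_sum A_ F x -> psi x = 0 -> x = 0.
  move=> fF [s [As _ ->]] psi0.
  rewrite fsbig1// => i Fi.
  have A0 j : A_ j 0 by exact: subcstar0 (graded_sub gA j).
  apply: (inj i); rewrite ?inE ?raddf0//; first exact: As.
  pose t := patch (fun=> 0) F (psi \o s).
  have -> : psi (s i) = t i by rewrite /t /patch mem_set.
  apply: ind => [j||].
  - rewrite /t /patch; case: ifPn => [/set_mem/As Aj|_]; first by exists (s j).
    by exists 0 => //; rewrite raddf0.
  - apply: sub_finite_set fF => j /=; rewrite /t /patch.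
    case: ifPn => [/set_mem//|_].
    by rewrite eqxx.
  - by rewrite -[RHS]psi0 -fsbig_mkcond !fsbig_finite// raddf_sum.
suff ker x : psi x = 0 -> x = 0.
  move=> x y /eqP; rewrite -subr_eq0 -raddfB => /eqP/ker/eqP.
  by rewrite subr_eq0 => /eqP.
move=> x0; apply: rnorm_small => e e0.
have [_ _ tA _] := gA.
(* 97 = 1 + 48 * 2: the distance from x to y, plus 48 times the bound of psi y. *)
have e97 : 0 < e / 97 by lra.
have [y /(linear_span_graded gA)[F [fF sF Fy]] xy] := dense_approx x tA e97.
have hS := algebraic_sum_sub_cstar_algebra gA fF sF.
have [||||z [Fz zy psiz]] := @bounded_lift _ _ _ psi _ _ hS (sub_cstar_algebra0 B)
  _ y (2 * (e / 97)) => //.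
- by move=> ? ? _ ->; rewrite /= cmulr0.
- lra.
- exists 0 => //; rewrite addr0 -[y](subKr x) raddfB/= x0 sub0r rnormN.
  by have := starhom_bound psi (x - y); lra.
have yz : y - z = 0 by apply: ker0 fF _ psiz; exact: subcstarB.
have := ler_rnormD (x - y) y; rewrite subrK; rewrite (subr0_eq yz) in xy *.
lra.
Qed.

End StarHomGraded.

Theorem proposition2p3p2 (R : realType) (d : Order.disp_t)
    (L : meetSemilatticeType d) (A : cstarAlgType R) (A_ : L -> set A)
    (gA : graded A_) (B : cstarAlgType R) (psi : {starhom A -> B}) :
  let psi_ (i : L) : A_ i -> B := sigL (A_ i) psi in
  let psi_on (F : set L) : algebraic_sum A_ F -> B :=
    sigL (algebraic_sum A_ F) psi in
  [/\ (forall (j k : L) (x : A_ j) (y : A_ k),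
         psi_ (j `&` k)%O (graded_mul gA x y) = psi_ j x ** psi_ k y),
      (set_surj [set: A] [set: B] psi <->
         total_family (fun i => range (psi_ i)))
    & [<-> injective psi;
           forall F : set L, finite_set F -> subsemilattice F ->
             injective (psi_on F);
           (forall i, injective (psi_ i)) /\
             linearly_independent (fun i => range (psi_ i))]].
Proof.
move=> psi_ psi_on.
have rangeE : (fun i => range (psi_ i)) = (fun i => psi @` A_ i).
  by apply/funext => i; exact: range_sigL.
split.
- by move=> j k x y; rewrite /psi_ /sigL/= starhomM.
- by rewrite rangeE; split; [exact: surjective_total|exact: total_surjective].
rewrite rangeE; tfae.
- by move=> inj F _ _; apply/sigL_injP => x y _ _; exact: inj.
- move=> inj; have inj' F : finite_set F -> subsemilattice F ->
      {in algebraic_sum A_ F &, injective psi}.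
    by move=> fF sF; exact/sigL_injP/inj.
  split; last exact: injective_on_sums_independent.
  move=> i; apply/sigL_injP; rewrite -(algebraic_sum1 A_ i); apply: inj'.
    exact: finite_set1.
  by move=> _ _ -> ->; rewrite /= meetxx.
- case=> inj ind; apply: (independent_injective gA _ ind) => i.
  exact/sigL_injP/inj.
Qed.
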